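(* For the property ''a graph is an $(i,j)$-biclique,'' the spanning variant of subgraph reconfiguration under the TJ rule is solvable in polynomial time when $i\ge 1$ is a fixed constant.
   Context: Graphs are finite, simple and undirected. An $(i,j)$-biclique is a complete bipartite graph whose bipartition classes have $i$ and $j$ vertices. In the spanning variant for property $\Pi$ on a graph $G$, a feasible solution is a vertex subset $V'\subseteq V(G)$ such that $G[V']$ contains a spanning subgraph satisfying $\Pi$. Under the token jumping (TJ) rule, two feasible solutions $X,Y$ are adjacent if $|X\setminus Y|=|Y\setminus X|=1$. A reconfiguration sequence is a sequence of feasible solutions in which consecutive ones are adjacent. The problem: given $G$ (and $j$) and feasible source and target solutions $V_s,V_t$, decide whether a reconfiguration sequence from $V_s$ to $V_t$ exists. *)

(* Defs.v *)
From HB Require Import structures.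
From mathcomp Require Import all_boot.

Set Implicit Arguments.
Unset Strict Implicit.
Unset Printing Implicit Defensive.

Record graph (T : finType) := Graph {
  adj :> rel T;
  adj_sym : symmetric adj;
  adj_irrefl : irreflexive adj }.

Definition induced_adj (T : finType) (G : graph T) (V : {set T}) :
    rel {x : T | x \in V} :=
  [rel x y | G (val x) (val y)].

Lemma induced_sym (T : finType) (G : graph T) (V : {set T}) :
  symmetric (induced_adj G (V := V)).
Proof. by move=> x y; exact: adj_sym. Qed.

Lemma induced_irrefl (T : finType) (G : graph T) (V : {set T}) :
  irreflexive (induced_adj G (V := V)).
Proof. by move=> x; exact: adj_irrefl. Qed.

Definition induced (T : finType) (G : graph T) (V : {set T}) :
    graph {x : T | x \in V} :=
  Graph (induced_sym G (V := V)) (induced_irrefl G (V := V)).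

Definition graph_property := forall T : finType, graph T -> Prop.

Definition spanning_subgraph (T : finType) (H G : graph T) : Prop :=
  forall x y, H x y -> G x y.

Definition biclique (i j : nat) : graph_property := fun T G =>
  exists A B : {set T},
    [/\ A :|: B = [set: T], [disjoint A & B], #|A| = i, #|B| = j &
        forall x y,
          G x y = (x \in A) && (y \in B) || (x \in B) && (y \in A)].

Definition feasible (P : graph_property) (T : finType) (G : graph T)
    (V : {set T}) : Prop :=
  exists2 H, spanning_subgraph H (induced G V) & P _ H.

Definition token_jump (T : finType) : rel {set T} :=
  [rel X Y | (#|X :\: Y| == 1) && (#|Y :\: X| == 1)].

Definition reconfigurable (P : graph_property) (T : finType) (G : graph T)
    (Vs Vt : {set T}) : Prop :=
  exists p : seq {set T},
    [/\ path (@token_jump T) Vs p, last Vs p = Vt &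
        forall X, X \in Vs :: p -> feasible P G X].

(* The model of computation: while programs over binary trees (Jones's WHILE  *)
(* language, with conditionals). Evaluating an expression is charged the      *)
(* total size of all the trees it produces, so that in time t a program can   *)
(* only build data of total size O(t) beyond its input; hence programs and    *)
(* multi-tape Turing machines simulate each other with polynomial overhead.   *)

Inductive tree := Nil | Cons of tree & tree.

Fixpoint tsize (t : tree) : nat :=
  if t is Cons a b then (tsize a + tsize b).+1 else 1.

Definition hd (t : tree) : tree := if t is Cons a _ then a else Nil.
Definition tl (t : tree) : tree := if t is Cons _ b then b else Nil.

Inductive expr :=
| EVar of nat
| ENil
| ECons of expr & expr
| EHd of expr
| ETl of expr.

Definition store := nat -> tree.

Fixpoint eval (s : store) (e : expr) : tree :=
  match e with
  | EVar x => s x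
  | ENil => Nil
  | ECons e1 e2 => Cons (eval s e1) (eval s e2)
  | EHd e1 => hd (eval s e1)
  | ETl e1 => tl (eval s e1)
  end.

Fixpoint ecost (s : store) (e : expr) : nat :=
  tsize (eval s e) +
  match e with
  | EVar _ | ENil => 0
  | ECons e1 e2 => ecost s e1 + ecost s e2
  | EHd e1 | ETl e1 => ecost s e1
  end.

Inductive com :=
| Assign of nat & expr
| Seq of com & com
| If of expr & com & com
| While of expr & com.

Definition update (s : store) (x : nat) (v : tree) : store :=
  fun y => if y == x then v else s y.

(* [exec c s t s']: run from the store s, c halts after time t in s'. In      *)
(* tests Nil is false and any other tree is true.                             *)
Inductive exec : com -> store -> nat -> store -> Prop :=
| ExecAssign x e s :
    exec (Assign x e) s (ecost s e) (update s x (eval s e))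
| ExecSeq c1 c2 s t1 s1 t2 s2 :
    exec c1 s t1 s1 -> exec c2 s1 t2 s2 ->
    exec (Seq c1 c2) s (t1 + t2) s2
| ExecIfTrue e c1 c2 s t s' :
    eval s e <> Nil -> exec c1 s t s' ->
    exec (If e c1 c2) s (ecost s e + t) s'
| ExecIfFalse e c1 c2 s t s' :
    eval s e = Nil -> exec c2 s t s' ->
    exec (If e c1 c2) s (ecost s e + t) s'
| ExecWhileTrue e c s t1 s1 t2 s2 :
    eval s e <> Nil -> exec c s t1 s1 -> exec (While e c) s1 t2 s2 ->
    exec (While e c) s (ecost s e + t1 + t2) s2
| ExecWhileFalse e c s :
    eval s e = Nil -> exec (While e c) s (ecost s e) s.

Definition init_store (input : tree) : store := update (fun=> Nil) 0 input.

(* A promise problem: the program is constrained on valid instances only. The *)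
(* input and the answer are both in variable 0.                               *)
Definition poly_time_solvable (I : Type) (encode : I -> tree)
    (valid yes : I -> Prop) : Prop :=
  exists (prog : com) (c k : nat), forall x : I, valid x ->
    exists (t : nat) (s : store),
      [/\ exec prog (init_store (encode x)) t s,
          t <= c * tsize (encode x) ^ k + c &
          s 0 <> Nil <-> yes x].

Record instance := Instance {
  order : nat;
  input_graph : graph 'I_order;
  param : nat;
  source : {set 'I_order};
  target : {set 'I_order} }.

Definition enc_seq : seq tree -> tree := foldr Cons Nil.
Definition enc_bool (b : bool) : tree := if b then Cons Nil Nil else Nil.
Definition enc_nat (n : nat) : tree := enc_seq (nseq n Nil).

Definition enc_pred (n : nat) (p : pred 'I_n) : tree :=
  enc_seq [seq enc_bool (p x) | x <- enum 'I_n].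

(* Graphs are given by adjacency matrices and vertex sets by characteristic   *)
(* vectors. The parameter is in unary; for bicliques this does not affect the *)
(* input size up to constant factors, as a feasible source forces it to be at *)
(* most the number of vertices.                                               *)
Definition encode (x : instance) : tree :=
  let G := input_graph x in
  enc_seq [:: enc_nat (param x);
              enc_seq [seq enc_pred (G u) | u <- enum 'I_(order x)];
              enc_pred [in source x];
              enc_pred [in target x]].

Definition spanning_valid (P : nat -> graph_property) (x : instance) : Prop :=
  feasible (P (param x)) (input_graph x) (source x) /\
  feasible (P (param x)) (input_graph x) (target x).

Definition spanning_yes (P : nat -> graph_property) (x : instance) : Prop :=
  reconfigurable (P (param x)) (input_graph x) (source x) (target x).

Definition spanning_TJ_poly_time (P : nat -> graph_property) : Prop :=
  poly_time_solvable encode (spanning_valid P) (spanning_yes P).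

(* Main.v *)
Require Import Defs.
From mathcomp Require Import all_boot.
From mathcomp Require Import zify.
(* Again, since [all_boot] exports other constants [Cons], [Nil], [tsize] and [order]. *)
Import Defs.

Set Implicit Arguments.
Unset Strict Implicit.
Unset Printing Implicit Defensive.

(* Let N[A] be the union of A and its common neighbourhood. A vertex set V is
   feasible iff |V| = i + j and A <= V <= N[A] for some A with |A| = i: the
   solutions form a union of at most n^i "slices". Any two solutions in one
   slice are joined by exchanging vertices outside A one at a time, so it
   remains to decide which slices contain equal or adjacent solutions. With
   k = i + j, the slices of A and B do iff |A \ N[B]| <= 1, |B \ N[A]| <= 1,
   |N[A] & N[B]| >= k - 1 and |A u B| <= k + 1, a condition that only involves
   counting. Reachability in the graph of slices is computed by iterating the
   one-step expansion as many times as there are words listing an i-set.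
   Polynomial running time follows from closing the functions computed by
   WHILE programs in polynomial time under pairing, composition, conditionals
   and folds whose intermediate values have polynomial size. *)

(** * Polynomial-time functions *)

(** The base [n.+2] is at least 2 even for [n = 0], so constants, sums and coefficients can all be
    absorbed into the exponent. *)
Definition pol (b : nat -> nat) := exists d, forall n, b n <= n.+2 ^ d.

Lemma leq_exp2rW m n d : m <= n -> m ^ d <= n ^ d.
Proof. by case: d => // d le_mn; rewrite leq_exp2r. Qed.

Lemma pol_id : pol id.
Proof. by exists 1 => n; rewrite expn1; lia. Qed.

Lemma pol_const a : pol (fun=> a).
Proof.
exists a => n; apply: leq_trans (_ : 2 ^ a <= _); first exact/ltnW/ltn_expl.
by case: a => // a; rewrite leq_exp2r.
Qed.

Lemma leq_expSS n d e : d <= e -> n.+2 ^ d <= n.+2 ^ e.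
Proof. by move=> le_de; rewrite leq_exp2l. Qed.

Lemma pol_add b1 b2 : pol b1 -> pol b2 -> pol (fun n => b1 n + b2 n).
Proof.
move=> [d1 h1] [d2 h2]; exists (maxn d1 d2).+1 => n.
have {}h1 := leq_trans (h1 n) (leq_expSS n (leq_maxl d1 d2)).
have {}h2 := leq_trans (h2 n) (leq_expSS n (leq_maxr d1 d2)).
rewrite expnS; nia.
Qed.

Lemma pol_mul b1 b2 : pol b1 -> pol b2 -> pol (fun n => b1 n * b2 n).
Proof.
move=> [d1 h1] [d2 h2]; exists (d1 + d2) => n.
by rewrite expnD leq_mul.
Qed.

Lemma pol_expSS b d : pol b -> pol (fun n => (b n).+2 ^ d).
Proof.
(* With [y = n.+2 ^ e >= 1], the shifted base is at most [y + 2 <= 4 * y], which is at most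
   [n.+2 ^ e.+2]. *)
move=> [e he]; exists (e.+2 * d) => n; rewrite expnM leq_exp2rW //.
have := he n; have : 0 < n.+2 ^ e by rewrite expn_gt0.
rewrite !expnS; nia.
Qed.

Lemma pol_S b : pol b -> pol (fun n => (b n).+1).
Proof.
by move=> hb; case: (pol_add (pol_const 1) hb) => d h; exists d.
Qed.

Ltac pol_auto :=
  match goal with
  | |- pol (fun n => n) => exact: pol_id
  | |- pol (fun=> _) => exact: pol_const
  | |- pol (muln _) => exact: (pol_mul (pol_const _) pol_id)
  | |- pol (addn _) => exact: (pol_add (pol_const _) pol_id)
  | |- pol (fun n => addn _ _) => apply: pol_add; pol_auto
  | |- pol (fun n => muln _ _) => apply: pol_mul; pol_auto
  | |- pol (fun n => expn (S (S _)) _) => apply: pol_expSS; pol_auto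
  | |- pol (fun n => S _) => apply: pol_S; pol_auto
  end.

(** * Running time and data size of WHILE programs *)

Definition runs (c : com) (s : store) (T : nat) (s' : store) :=
  exists2 t, exec c s t s' & t <= T.

Lemma runs_le c s T T' s' : T <= T' -> runs c s T s' -> runs c s T' s'.
Proof. by move=> le_T [t e le_t]; exists t => //; apply: leq_trans le_T. Qed.

Lemma runs_assign x e s : runs (Assign x e) s (ecost s e) (update s x (eval s e)).
Proof. by exists (ecost s e) => //; constructor. Qed.

Lemma runs_seq c1 c2 s T1 T2 s1 s2 :
  runs c1 s T1 s1 -> runs c2 s1 T2 s2 -> runs (Seq c1 c2) s (T1 + T2) s2.
Proof.
by move=> [t1 e1 h1] [t2 e2 h2]; exists (t1 + t2); [exact: ExecSeq e1 e2|exact: leq_add].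
Qed.

Fixpoint esize (e : expr) : nat :=
  match e with
  | EVar _ | ENil => 1
  | ECons e1 e2 => (esize e1 + esize e2).+1
  | EHd e1 | ETl e1 => (esize e1).+1
  end.

Fixpoint evars (e : expr) : seq nat :=
  match e with
  | EVar x => [:: x]
  | ENil => [::]
  | ECons e1 e2 => evars e1 ++ evars e2
  | EHd e1 | ETl e1 => evars e1
  end.

Lemma tsize_gt0 t : 0 < tsize t. Proof. by case: t. Qed.

Lemma tsize_hd t : tsize (hd t) <= tsize t.
Proof. by case: t => //= a b; lia. Qed.

Lemma tsize_tl t : tsize (tl t) <= tsize t.
Proof. by case: t => //= a b; lia. Qed.

(** Each node of the expression is charged the size of its value, which is at most [esize e * N],
    and there are [esize e] nodes; hence the square in the cost. *)
Lemma eval_size s e N : 0 < N -> all (fun x => tsize (s x) <= N) (evars e) ->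
  tsize (eval s e) <= esize e * N /\ ecost s e <= esize e ^ 2 * N.
Proof.
move=> N0; elim: e => [x||e1 IH1 e2 IH2|e IH|e IH] /=.
- by rewrite andbT => h; split; lia.
- by move=> _; split; lia.
- rewrite all_cat => /andP[/IH1[s1 c1] /IH2[s2 c2]]; split; nia.
- move=> /IH[h c]; have := tsize_hd (eval s e); split; nia.
- move=> /IH[h c]; have := tsize_tl (eval s e); split; nia.
Qed.

Lemma runs_assignN x e s N : 0 < N ->
  all (fun y => tsize (s y) <= N) (evars e) ->
  runs (Assign x e) s (esize e ^ 2 * N) (update s x (eval s e)).
Proof. by move=> N0 h; apply: runs_le (runs_assign _ _ _); apply: (proj2 (eval_size N0 h)). Qed.

(** An assignment costs at least the size of the tree that it stores, so time bounds growth. *)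
Lemma exec_size c s t s' y : exec c s t s' -> tsize (s' y) <= tsize (s y) + t.
Proof.
elim=> {c s t s'} [x e s|*|*|*|*|*]; try lia.
rewrite /update; case: eqP => // _; last by lia.
by case: e => /= *; lia.
Qed.

(** * Encoded types and basic closure properties *)

Record encType := EncType { esort :> Type; enc : esort -> tree }.
Arguments enc {e} _.

Definition enc_pair (X Y : encType) (p : X * Y) : tree := Cons (enc p.1) (enc p.2).
Definition enc_list (X : encType) (s : seq X) : tree := enc_seq (map enc s).

Canonical unit_enc := EncType (fun _ : unit => Nil).
Canonical bool_enc := EncType enc_bool.
Canonical nat_enc := EncType enc_nat.
Canonical prod_enc (X Y : encType) := EncType (@enc_pair X Y).
Canonical seq_enc (X : encType) := EncType (@enc_list X).

Notation esz x := (tsize (enc x)).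

(* A program may clobber variables up to [m] only, and may not rely on the
   contents of variables other than 0, so programs compose without renaming:
   data is saved above the bounds of the subprograms. *)
Definition ptime (X Y : encType) (f : X -> Y) :=
  exists (c : com) (m d : nat), forall (x : X) (s : store), s 0 = enc x ->
    exists s', [/\ runs c s ((esz x).+2 ^ d) s', s' 0 = enc (f x) &
                   forall y, m < y -> s' y = s y].

Lemma ptimeI (X Y : encType) (f : X -> Y) c m b : pol b ->
  (forall (x : X) (s : store), s 0 = enc x ->
    exists s', [/\ runs c s (b (esz x)) s', s' 0 = enc (f x) &
                   forall y, m < y -> s' y = s y]) -> ptime f.
Proof.
move=> [d hd] h; exists c, m, d => x s /h[s' [r e fr]]; exists s'; split=> //.
exact: runs_le r.
Qed.

Lemma ptime_ext (X Y : encType) (f g : X -> Y) : f =1 g -> ptime f -> ptime g.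
Proof.
by move=> fg [c [m [d h]]]; exists c, m, d => x s /h[s' [r e fr]]; exists s'; rewrite -fg.
Qed.

(** Variable 0 starts as the input and grows by at most the running time, which is itself
    polynomial. *)
Lemma ptime_size (X Y : encType) (f : X -> Y) : ptime f ->
  exists d, forall x, esz (f x) <= (esz x).+2 ^ d.
Proof.
move=> [c [m [d h]]].
have [d' hd'] : pol (fun n => n + n.+2 ^ d) by pol_auto.
exists d' => x; case: (h x (update (fun=> Nil) 0 (enc x))) => // s' [[t e le_t] <- _].
apply: leq_trans (hd' _); apply: leq_trans (exec_size 0 e) _ => /=.
by rewrite leq_add2l.
Qed.

Lemma ptime_expr (X Y : encType) (f : X -> Y) e : all (pred1 0) (evars e) ->
  (forall s x, s 0 = enc x -> eval s e = enc (f x)) -> ptime f.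
Proof.
move=> e0 he; apply: (@ptimeI _ _ _ (Assign 0 e) 0 (fun n => esize e ^ 2 * n)).
  by pol_auto.
move=> x s sx; exists (update s 0 (eval s e)); split=> [||y]; last first.
- by rewrite /update; case: y.
- by rewrite /update /= (he s x).
apply: runs_le (runs_assign _ _ _).
apply: (proj2 (eval_size (tsize_gt0 _) _)).
by apply: sub_all e0 => y /eqP ->; rewrite sx.
Qed.

(** The second program is timed in terms of [f x], whose size [ptime_size] bounds polynomially in
    that of [x]. *)
Lemma ptime_comp (X Y Z : encType) (g : Y -> Z) (f : X -> Y) :
  ptime g -> ptime f -> ptime (fun x => g (f x)).
Proof.
move=> [cg [mg [dg hg]]] pf; have [df' sf] := ptime_size pf.
case: pf => cf [mf [df hf]].
apply: (@ptimeI _ _ _ (Seq cf cg) (maxn mf mg)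
  (fun n => n.+2 ^ df + (n.+2 ^ df').+2 ^ dg)); first by pol_auto.
move=> x s /hf[s1 [r1 e1 fr1]]; have [s2 [r2 e2 fr2]] := hg _ _ e1.
exists s2; split=> // [|y]; last by rewrite gtn_max => /andP[? ?]; rewrite fr2 ?fr1.
apply: runs_seq r1 _; apply: runs_le r2.
by apply: leq_exp2rW; rewrite !ltnS.
Qed.

Lemma updateE s x v y : update s x v y = if y == x then v else s y.
Proof. by []. Qed.

Lemma ptime_pair (X Y Z : encType) (f : X -> Y) (g : X -> Z) :
  ptime f -> ptime g -> ptime (fun x => (f x, g x)).
Proof.
move=> pf pg; have [df' sf] := ptime_size pf; have [dg' sg] := ptime_size pg.
case: pf pg => cf [mf [df hf]] [cg [mg [dg hg]]].
(* [M] keeps the input while [cf] runs, and [M.+1] keeps the value of [f] while [cg] runs. *)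
pose M := (maxn mf mg).+1.
have Mf : mf < M by rewrite ltnS leq_maxl.
have Mg : mg < M by rewrite ltnS leq_maxr.
apply: (@ptimeI _ _ _
  (Seq (Assign M (EVar 0)) (Seq cf (Seq (Assign M.+1 (EVar 0))
     (Seq (Assign 0 (EVar M)) (Seq cg (Assign 0 (ECons (EVar M.+1) (EVar 0)))))))) M.+1
  (fun n => n + (n.+2 ^ df + (n.+2 ^ df' + (n + (n.+2 ^ dg +
     (3 * (n.+2 ^ df' + n.+2 ^ dg')).+1)))))); first by pol_auto.
move=> x s sx.
case: (hf x (update s M (s 0))) => [|s1 [r1 e1 fr1]]; first by rewrite updateE.
case: (hg x (update (update s1 M.+1 (s1 0)) 0 (s1 M))) => [|s2 [r2 e2 fr2]].
  by rewrite updateE eqxx fr1 // updateE eqxx.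
have es1M : s1 M = enc x by rewrite fr1 // updateE eqxx.
have es2M : s2 M.+1 = enc (f x).
  by rewrite fr2 1?ltnW // updateE /= updateE eqxx.
exists (update s2 0 (eval s2 (ECons (EVar M.+1) (EVar 0)))); split.
- apply: runs_seq.
    by apply: runs_le (runs_assign _ _ _); rewrite /= sx addn0.
  apply: runs_seq r1 _; apply: runs_seq.
    by apply: runs_le (runs_assign _ _ _); rewrite /= e1 addn0.
  apply: runs_seq.
    by apply: runs_le (runs_assign _ _ _); rewrite /= updateE ltn_eqF // es1M addn0.
  apply: runs_seq.
    have -> : eval (update s1 M.+1 (eval s1 (EVar 0))) (EVar M) = s1 M.
      by rewrite /= updateE ltn_eqF.
    exact: r2.
  apply: runs_le (runs_assign _ _ _); rewrite /= es2M e2.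
  by have := sf x; have := sg x; lia.
- by rewrite updateE /= es2M e2.
- move=> y ltMy; rewrite updateE; have /negbTE-> : y != 0 by lia.
  rewrite fr2 ?updateE; last by lia.
  have /negbTE-> : y != 0 by lia.
  have /negbTE-> : y != M.+1 by lia.
  rewrite fr1 ?updateE; last by lia.
  by have /negbTE-> : y != M by lia.
Qed.

Lemma ptime_if_pair (X Y : encType) (f g : X -> Y) :
  ptime f -> ptime g -> ptime (fun p : bool * X => if p.1 then f p.2 else g p.2).
Proof.
move=> [cf [mf [df hf]]] [cg [mg [dg hg]]].
(* The chosen branch expects its bare argument in variable 0, so the test bit is first moved to
   [M]. *)
pose M := (maxn mf mg).+1.
have Mf : mf < M by rewrite ltnS leq_maxl.
have Mg : mg < M by rewrite ltnS leq_maxr.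
apply: (@ptimeI _ _ _
  (Seq (Assign M (EHd (EVar 0))) (Seq (Assign 0 (ETl (EVar 0)))
     (If (EVar M) cf cg))) M
  (fun n => 2 ^ 2 * n + (2 ^ 2 * n + (n + (n.+2 ^ df + n.+2 ^ dg))))); first by pol_auto.
move=> [b x] s /= sx.
set s1 := update s M (hd (s 0)); set s2 := update s1 0 (tl (s1 0)).
have s20 : s2 0 = enc x by rewrite /s2 /s1 !updateE /= sx.
have s2M : s2 M = enc_bool b by rewrite /s2 /s1 !updateE /= eqxx sx.
have [s3 [r3 e3 fr3]] : exists s3, [/\ runs (If (EVar M) cf cg) s2
    (esz (b, x) + ((esz (b,x)).+2 ^ df + (esz (b, x)).+2 ^ dg)) s3,
    s3 0 = enc (if b then f x else g x) & forall y, M < y -> s3 y = s2 y].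
  have le_x : (esz x).+2 <= (esz (b, x)).+2 by rewrite /=; lia.
  have le_b : tsize (enc_bool b) <= esz (b, x) by rewrite /=; lia.
  case: b s2M le_x le_b {sx} => s2M le_x le_b.
    have [s3 [[t r3 lt] e3 fr3]] := hf _ _ s20; exists s3; split=> //.
      exists (ecost s2 (EVar M) + t); first by apply: ExecIfTrue r3; rewrite /= s2M.
      rewrite /= s2M addn0; apply: leq_add => //.
      apply: leq_trans lt _; apply: leq_trans (leq_exp2rW _ le_x) _.
      exact: leq_addr.
    by move=> y hy; apply: fr3; lia.
  have [s3 [[t r3 lt] e3 fr3]] := hg _ _ s20; exists s3; split=> //.
    exists (ecost s2 (EVar M) + t); first by apply: ExecIfFalse r3; rewrite /= s2M.
    rewrite /= s2M addn0; apply: leq_add => //.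
    apply: leq_trans lt _; apply: leq_trans (leq_exp2rW _ le_x) _.
    exact: leq_addl.
  by move=> y hy; apply: fr3; lia.
exists s3; split=> //; last first.
  move=> y hy; rewrite fr3 // /s2 /s1 !updateE.
  have /negbTE-> : y != 0 by lia.
  by have /negbTE-> : y != M by lia.
apply: runs_seq.
  by apply: (@runs_assignN _ (EHd (EVar 0))) (tsize_gt0 (enc (b, x))) _; rewrite /= sx leqnn.
apply: runs_seq.
  apply: (@runs_assignN _ (ETl (EVar 0))) (tsize_gt0 (enc (b, x))) _.
  by rewrite /s1 /= updateE /= sx leqnn.
exact: r3.
Qed.

Lemma ptime_id (X : encType) : ptime (@id X).
Proof. by apply: (@ptime_expr _ _ _ (EVar 0)) => //= s x ->. Qed.

Lemma ptime_fst (X Y Z : encType) (f : X -> Y * Z) :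
  ptime f -> ptime (fun x => (f x).1).
Proof.
apply: (@ptime_comp X _ Y fst).
by apply: (@ptime_expr _ _ _ (EHd (EVar 0))) => //= s x ->.
Qed.

Lemma ptime_snd (X Y Z : encType) (f : X -> Y * Z) :
  ptime f -> ptime (fun x => (f x).2).
Proof.
apply: (@ptime_comp X _ Z snd).
by apply: (@ptime_expr _ _ _ (ETl (EVar 0))) => //= s x ->.
Qed.

Lemma ptime_comp2 (X Y Z W : encType) (h : Y -> Z -> W) (f : X -> Y) (g : X -> Z) :
  ptime (fun p : Y * Z => h p.1 p.2) -> ptime f -> ptime g ->
  ptime (fun x => h (f x) (g x)).
Proof.
by move=> ph pf pg; apply: (@ptime_comp _ _ _ (fun p => h p.1 p.2) _ ph (ptime_pair pf pg)).
Qed.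

Fixpoint etree (t : tree) : expr :=
  if t is Cons a b then ECons (etree a) (etree b) else ENil.

Lemma ptime_const (X Y : encType) (y : Y) : ptime (fun _ : X => y).
Proof.
apply: (@ptime_expr _ _ _ (etree (enc y))) => [|s _ _].
  by elim: (enc y) => //= a ha b hb; rewrite all_cat ha.
by elim: (enc y) => //= a -> b ->.
Qed.

Lemma ptime_if (X Y : encType) (b : X -> bool) (f g : X -> Y) :
  ptime b -> ptime f -> ptime g -> ptime (fun x => if b x then f x else g x).
Proof.
move=> pb pf pg.
exact: (ptime_comp (ptime_if_pair pf pg) (ptime_pair pb (@ptime_id X))).
Qed.

Lemma ptime_cons (X Y : encType) (f : X -> Y) (g : X -> seq Y) :
  ptime f -> ptime g -> ptime (fun x => f x :: g x).
Proof.
apply: (ptime_comp2 (h := cons)).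
by apply: (@ptime_expr _ _ _ (EVar 0)) => //= s x ->.
Qed.

Lemma ptime_behead (X Y : encType) (f : X -> seq Y) :
  ptime f -> ptime (fun x => behead (f x)).
Proof.
apply: (@ptime_comp X _ _ behead).
by apply: (@ptime_expr _ _ _ (ETl (EVar 0))) => //= s [|y l] ->.
Qed.

(** The expression [EHd] returns [Nil] on the empty list, so the default value must be the one
    encoded by [Nil]. *)
Lemma ptime_head (X Y : encType) (y0 : Y) (f : X -> seq Y) : enc y0 = Nil ->
  ptime f -> ptime (fun x => head y0 (f x)).
Proof.
move=> y0N; apply: (@ptime_comp X _ _ (head y0)).
by apply: (@ptime_expr _ _ _ (EHd (EVar 0))) => //= s [|y l] ->.
Qed.

(** * Folds over lists *)

Lemma esz_cons (X : encType) (y : X) (l : seq X) : esz (y :: l) = (esz y + esz l).+1.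
Proof. by []. Qed.

Lemma esz_pair (X Y : encType) (x : X) (y : Y) : esz (x, y) = (esz x + esz y).+1.
Proof. by []. Qed.

(* Variable [M] holds the triple [(x, (list, accumulator))]. *)
Definition foldl_load M :=
  ECons (EHd (EVar M)) (ECons (EHd (EHd (ETl (EVar M)))) (ETl (ETl (EVar M)))).
Definition foldl_save M :=
  ECons (EHd (EVar M)) (ECons (ETl (EHd (ETl (EVar M)))) (EVar 0)).
Definition foldl_body c M :=
  Seq (Assign 0 (foldl_load M)) (Seq c (Assign M (foldl_save M))).
Definition foldl_loop c M := While (EHd (ETl (EVar M))) (foldl_body c M).

Lemma runs_foldl (X Y A : encType) (F : X -> Y -> A -> A) c m M d N B :
  m < M ->
  (forall x y a s, s 0 = enc (x, (y, a)) -> exists s',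
    [/\ runs c s ((esz (x, (y, a))).+2 ^ d) s', s' 0 = enc (F x y a) &
        forall z, m < z -> s' z = s z]) ->
  forall (x : X) (l : seq Y) (a : A) (s : store),
  s M = enc (x, (l, a)) ->
  (forall k, esz (foldl (fun a y => F x y a) a (take k l)) <= B) ->
  esz x + esz l + B + 2 <= N ->
  exists s',
    [/\ runs (foldl_loop c M)
          s ((size l).+1 * (9 * N + (121 * N + (N.+2 ^ d + 81 * N)))) s',
        s' M = enc (x, ([::] : seq Y, foldl (fun a y => F x y a) a l)) &
        forall z, M < z -> s' z = s z].
Proof.
move=> ltmM hc x l; elim: l => [|y l IH] a s sM hB hN.
  have N0 : 0 < N by lia.
  exists s; split=> //; exists (ecost s (EHd (ETl (EVar M)))).
    by apply: ExecWhileFalse; rewrite /= sM.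
  rewrite mul1n; apply: leq_trans (leq_addr _ _).
  apply: (proj2 (@eval_size s (EHd (ETl (EVar M))) N N0 _)).
  rewrite /= sM andbT; apply: leq_trans hN; have := hB 0; rewrite !esz_pair /=; lia.
have N0 : 0 < N by lia.
have szM : tsize (s M) <= N.
  by rewrite sM; apply: leq_trans hN; have := hB 0; rewrite !esz_pair /=; lia.
pose s1 := update s 0 (enc (x, (y, a))).
have s1M : s1 M = s M by rewrite /s1 updateE gtn_eqF //; lia.
have [|s2 [r2 e2 fr2]] := hc x y a s1; first by rewrite /s1 updateE.
have s2M : s2 M = s M by rewrite fr2.
pose s3 := update s2 M (enc (x, (l, F x y a))).
have [|||s4 [r4 e4 fr4]] := IH (F x y a) s3.
- by rewrite /s3 updateE eqxx.
- by move=> k; apply: (hB k.+1).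
- by apply: leq_trans hN; rewrite esz_cons; lia.
exists s4; split=> //; last first.
  move=> z hz; rewrite fr4 // /s3 updateE gtn_eqF // fr2; last exact: ltn_trans hz.
  by rewrite /s1 updateE gtn_eqF //; lia.
have ha : esz (x, (y, a)) <= N.
  by apply: leq_trans hN; have := hB 0; rewrite !esz_pair esz_cons /=; lia.
have hFa : esz (F x y a) <= N.
  by have := hB 1; rewrite /= take0 /=; lia.
have rb : runs (foldl_body c M)
          s (121 * N + (N.+2 ^ d + 81 * N)) s3.
  apply: (@runs_seq _ _ _ _ _ s1).
    have -> : s1 = update s 0 (eval s (foldl_load M)) by rewrite /= sM.
    apply: (@runs_assignN 0 (foldl_load M)) N0 _.
    by rewrite /= szM.
  apply: (@runs_seq _ _ _ _ _ s2).
    by apply: runs_le r2; apply: leq_exp2rW; rewrite !ltnS.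
  have -> : s3 = update s2 M (eval s2 (foldl_save M)).
    by rewrite /= s2M sM e2.
  apply: (@runs_assignN M (foldl_save M)) N0 _.
  by rewrite /= s2M szM e2 hFa.
case: rb r4 => [tb eb lb] [t4 x4 l4].
exists (ecost s (EHd (ETl (EVar M))) + tb + t4).
  by apply: ExecWhileTrue eb x4; rewrite /= sM.
rewrite [(size _).+1]/= mulSn; apply: leq_add l4.
apply: leq_add lb; apply: (proj2 (@eval_size s (EHd (ETl (EVar M))) N N0 _)).
by rewrite /= szM.
Qed.

Lemma size_enc_seq (X : encType) (l : seq X) : size l < esz l.
Proof. by elim: l => // x l IH; rewrite esz_cons ltnS; apply: leq_trans IH (leq_addl _ _). Qed.

(** The size hypothesis concerns the accumulator after every prefix of the list: iterating a
    polynomial-time step could otherwise produce exponentially large values. *)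
Lemma ptime_foldl (X Y A : encType) (F : X -> Y -> A -> A) (g : X -> seq Y) (i : X -> A) d' :
  ptime (fun p : X * (Y * A) => F p.1 p.2.1 p.2.2) -> ptime g -> ptime i ->
  (forall x k, esz (foldl (fun a y => F x y a) (i x) (take k (g x))) <= (esz x).+2 ^ d') ->
  ptime (fun x => foldl (fun a y => F x y a) (i x) (g x)).
Proof.
move=> pF pg pi hB.
have [c [m [d hc]]] := pF.
have [eg sg] := ptime_size pg.
have [cp [mp [dp hp]]] := ptime_pair (@ptime_id X) (ptime_pair pg pi).
have [ep sp] := ptime_size (ptime_pair (@ptime_id X) (ptime_pair pg pi)).
pose M := (maxn m mp).+1.
have Mm : m < M by rewrite ltnS leq_maxl.
have Mp : mp < M by rewrite ltnS leq_maxr.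
(* The summands bound the argument, the list, the accumulator and the two pairing nodes of the
   triple. *)
pose NN n := n + n.+2 ^ eg + n.+2 ^ d' + 2.
have pN : pol NN by rewrite /NN; pol_auto.
case: (pN) => eN heN.
apply: (@ptimeI _ _ _ (Seq cp (Seq (Assign M (EVar 0)) (Seq
   (foldl_loop c M)
   (Assign 0 (ETl (ETl (EVar M)))))))
   M (fun n => n.+2 ^ dp + (n.+2 ^ ep + ((n.+2 ^ eg).+1 *
        (9 * NN n + (121 * NN n + ((NN n).+2 ^ d + 81 * NN n))) + 9 * (n + 1 + n.+2 ^ d' + 2))))).
  by rewrite /NN; pol_auto.
move=> x s /hp[s1 [r1 e1 fr1]].
pose s2 := update s1 M (enc (x, (g x, i x))).
have [|||s3 [r3 e3 fr3]] := @runs_foldl X Y A F c m M d (NN (esz x)) ((esz x).+2 ^ d')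
   Mm _ x (g x) (i x) s2 _ (hB x) _.
- by move=> x' y a s'; apply: (hc (x', (y, a))).
- by rewrite /s2 updateE eqxx.
- by rewrite /NN !leq_add2r leq_add2l; apply: sg.
exists (update s3 0 (enc (foldl (fun a y => F x y a) (i x) (g x)))); split; last first.
- move=> y hy; rewrite updateE gtn_eqF; last by lia.
  by rewrite fr3 // /s2 updateE gtn_eqF // fr1 //; lia.
- by rewrite updateE.
apply: runs_seq r1 _; apply: (@runs_seq _ _ _ _ _ s2).
  have -> : s2 = update s1 M (eval s1 (EVar 0)) by rewrite /= e1.
  apply: runs_le (runs_assign _ _ _); rewrite /= addn0 e1; exact: sp.
apply: (@runs_seq _ _ _ _ _ s3).
  apply: runs_le r3; rewrite leq_mul2r ltnS (leq_trans _ (sg x)) ?orbT //.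
  exact/ltnW/size_enc_seq.
have -> : enc (foldl (fun a y => F x y a) (i x) (g x)) = eval s3 (ETl (ETl (EVar M))).
  by rewrite /= e3.
apply: (@runs_assignN 0 (ETl (ETl (EVar M)))); first by lia.
rewrite /= e3 /= andbT; have := hB x (size (g x)); rewrite take_size /=; lia.
Qed.

Arguments enc : simpl never.
Arguments Defs.tsize : simpl never.

Lemma ptime_foldlB b (X Y A : encType) (F : X -> Y -> A -> A) (g : X -> seq Y) (i : X -> A) :
  pol b -> ptime (fun p : X * (Y * A) => F p.1 p.2.1 p.2.2) -> ptime g -> ptime i ->
  (forall x k, esz (foldl (fun a y => F x y a) (i x) (take k (g x))) <= b (esz x)) ->
  ptime (fun x => foldl (fun a y => F x y a) (i x) (g x)).
Proof.
move=> [d hd] pF pg pi hb; apply: (ptime_foldl (d' := d)) => // x k.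
exact: leq_trans (hb x k) (hd _).
Qed.

(** * List operations and Boolean tests *)

Lemma esz_catrev (X : encType) (l1 l2 : seq X) : (esz (catrev l1 l2)).+1 = esz l1 + esz l2.
Proof.
elim: l1 l2 => [|x l1 IH] l2 /=; first by rewrite add1n.
by rewrite IH !esz_cons; lia.
Qed.

Lemma esz_rev (X : encType) (l : seq X) : esz (rev l) = esz l.
Proof. by apply: succn_inj; rewrite esz_catrev addn1. Qed.

Lemma esz_take (X : encType) k (l : seq X) : esz (take k l) <= esz l.
Proof.
elim: l k => [|x l IH] [|k] //=.
by rewrite !esz_cons ltnS leq_add2l.
Qed.

Lemma ptime_catrev (X Y : encType) (f g : X -> seq Y) :
  ptime f -> ptime g -> ptime (fun x => catrev (f x) (g x)).
Proof.
move=> pf pg; have [df sf] := ptime_size pf; have [dg sg] := ptime_size pg.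
have catrevE l1 l2 : catrev l1 l2 = foldl (fun (a : seq Y) y => y :: a) l2 l1.
  by elim: l1 l2 => //=.
apply: (@ptime_ext _ _ (fun x => foldl (fun a y => y :: a) (g x) (f x))) => [x|].
  by rewrite catrevE.
apply: (@ptime_foldlB (fun n => n.+2 ^ df + n.+2 ^ dg) _ _ _ (fun _ => cons) f g) => //.
- by pol_auto.
- by apply: ptime_cons; [apply: ptime_fst|apply: ptime_snd]; apply: ptime_snd; apply: ptime_id.
- move=> x k; rewrite -catrevE.
  by have := esz_catrev (take k (f x)) (g x); have := esz_take k (f x);
     have := sf x; have := sg x; lia.
Qed.

Lemma ptime_rev (X Y : encType) (f : X -> seq Y) : ptime f -> ptime (fun x => rev (f x)).
Proof. by move=> pf; apply: ptime_catrev pf _; apply: ptime_const. Qed.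

Lemma ptime_cat (X Y : encType) (f g : X -> seq Y) :
  ptime f -> ptime g -> ptime (fun x => f x ++ g x).
Proof.
move=> pf pg; apply: (@ptime_ext _ _ (fun x => catrev (rev (f x)) (g x))) => [x|].
  by rewrite catrevE revK.
by apply: ptime_catrev pg; apply: ptime_rev.
Qed.

Lemma leq_esz_map (X Y : encType) (f : X -> Y) (B : nat) (l : seq X) :
  (forall x, esz x <= esz l -> esz (f x) <= B) -> esz (map f l) <= (esz l).+1 * B.+2.
Proof.
(* The induction runs over shorter lists [l'] while the entry bound [B] stays tied to the original
   [l]. *)
move=> hB; suff : forall l', esz l' <= esz l -> esz (map f l') <= (size l').+1 * B.+2.
  move=> /(_ l (leqnn _)) h; apply: leq_trans h _.
  by rewrite leq_mul2r !ltnS (ltnW (size_enc_seq l)) orbT.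
elim=> [|x l' IH]; first by rewrite mul1n.
rewrite /= !esz_cons => le_l; rewrite mulSn.
have hx : esz (f x) <= B by apply: hB; lia.
have hl' : esz (map f l') <= (size l').+1 * B.+2 by apply: IH; lia.
lia.
Qed.

Lemma ptime_map (X Y Z : encType) (f : X -> Y -> Z) (g : X -> seq Y) :
  ptime (fun p : X * Y => f p.1 p.2) -> ptime g ->
  ptime (fun x => map (f x) (g x)).
Proof.
move=> pf pg; have [dg sg] := ptime_size pg; have [df sf] := ptime_size pf.
have mapE x l a : foldl (fun a y => f x y :: a) a l = catrev (map (f x) l) a.
  by elim: l a => //=.
apply: (@ptime_ext _ _ (fun x => rev (foldl (fun a y => f x y :: a) [::] (g x)))) => [x|].
  by rewrite mapE revK.
apply: ptime_rev.
pose B n := (n + n.+2 ^ dg).+1.+2 ^ df.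
apply: (@ptime_foldlB (fun n => (n.+2 ^ dg).+1 * (B n).+2) _ _ _ (fun x y => cons (f x y))) => //.
- by rewrite /B; pol_auto.
- apply: ptime_cons; last by apply/ptime_snd/ptime_snd/ptime_id.
  apply: (ptime_comp2 pf); first exact/ptime_fst/ptime_id.
  exact/ptime_fst/ptime_snd/ptime_id.
- exact: ptime_const.
- move=> x k; rewrite mapE esz_rev.
  have hk := leq_trans (esz_take k (g x)) (sg x).
  apply: leq_trans (leq_esz_map (B := B (esz x)) _) _ => [y hy|].
    apply: leq_trans (sf (x, y)) _; apply: leq_exp2rW.
    by rewrite esz_pair !ltnS leq_add2l; apply: leq_trans hk.
  by rewrite leq_mul2r ltnS hk orbT.
Qed.

Lemma ptime_flatten (X Y : encType) (g : X -> seq (seq Y)) :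
  ptime g -> ptime (fun x => flatten (g x)).
Proof.
move=> pg; have [dg sg] := ptime_size pg.
have flatE l (a : seq Y) : foldl (fun a y => a ++ y) a l = a ++ flatten l.
  by elim: l a => [|x l IH] a /=; rewrite ?cats0 // IH catA.
have le_flat (l : seq (seq Y)) : esz (flatten l) <= esz l.
  elim: l => // x l IH; rewrite /= esz_cons.
  have -> : x ++ flatten l = catrev (rev x) (flatten l) by rewrite catrevE revK.
  by have := esz_catrev (rev x) (flatten l); rewrite esz_rev; lia.
apply: (@ptime_ext _ _ (fun x => foldl (fun a y => a ++ y) [::] (g x))) => [x|].
  by rewrite flatE.
apply: (@ptime_foldlB (fun n => n.+2 ^ dg) _ _ _ (fun _ y a => a ++ y)) => //.
- by pol_auto.
- by apply: ptime_cat; [apply: ptime_snd|apply: ptime_fst]; apply: ptime_snd; apply: ptime_id.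
- exact: ptime_const.
- move=> x k; rewrite flatE; apply: leq_trans (le_flat _) _.
  exact: leq_trans (esz_take _ _) (sg x).
Qed.

Lemma ptime_filter (X Y : encType) (f : X -> Y -> bool) (g : X -> seq Y) :
  ptime (fun p : X * Y => f p.1 p.2) -> ptime g ->
  ptime (fun x => filter (f x) (g x)).
Proof.
move=> pf pg.
apply: (@ptime_ext _ _ (fun x => flatten (map (fun y => if f x y then [:: y] else [::]) (g x)))).
  by move=> x; elim: (g x) => //= y l ->; case: (f x y).
apply: ptime_flatten; apply: (ptime_map (f := fun x y => if f x y then [:: y] else [::])) => //.
apply: ptime_if => //; last exact: ptime_const.
by apply: ptime_cons; [exact/ptime_snd/ptime_id|exact: ptime_const].
Qed.

Lemma ptime_size_seq (X Y : encType) (g : X -> seq Y) :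
  ptime g -> ptime (fun x => size (g x)).
Proof.
move=> pg; apply: (@ptime_comp _ _ _ size _ _ pg).
(* A list of [tt] has the same tree as the unary encoding of its length, so after this map the
   identity program computes [size]. *)
have p1 : ptime (fun l : seq Y => map (fun=> tt) l).
  by apply: (ptime_map (f := fun _ _ => tt)) (@ptime_id _); apply: ptime_const.
apply: (@ptime_ext _ _ (fun l => size (map (fun=> tt) l))) => [l|]; first by rewrite size_map.
apply: (@ptime_comp _ (seq_enc unit_enc) _ size _ _ p1).
apply: (@ptime_expr _ _ _ (EVar 0)) => // s x /= ->; elim: x => // -[] l IH.
exact: (congr1 (Cons Nil) IH).
Qed.

Lemma ptime_count (X Y : encType) (f : X -> Y -> bool) (g : X -> seq Y) :
  ptime (fun p : X * Y => f p.1 p.2) -> ptime g ->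
  ptime (fun x => count (f x) (g x)).
Proof.
move=> pf pg; apply: (@ptime_ext _ _ (fun x => size (filter (f x) (g x)))).
  by move=> x; rewrite size_filter.
exact/ptime_size_seq/ptime_filter.
Qed.

Lemma ptime_nilp (X Y : encType) (g : X -> seq Y) : ptime g -> ptime (fun x => nilp (g x)).
Proof.
(* An entry may itself be encoded by [Nil], so the head is only tested after all entries are
   replaced by [true]. *)
move=> pg; have : ptime (fun x => if head false (map (fun=> true) (g x)) then false else true).
  apply: ptime_if; [apply: ptime_head => //|exact: ptime_const..].
  by apply: (ptime_map (f := fun _ _ => true)) pg; apply: ptime_const.
by apply: ptime_ext => x; case: (g x).
Qed.

Lemma ptime_negb (X : encType) (f : X -> bool) : ptime f -> ptime (fun x => ~~ f x).
Proof.
move=> pf; apply: (@ptime_ext _ _ (fun x => if f x then false else true)) => [x|].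
  by case: (f x).
by apply: ptime_if pf _ _; apply: ptime_const.
Qed.

Lemma ptime_andb (X : encType) (f g : X -> bool) :
  ptime f -> ptime g -> ptime (fun x => f x && g x).
Proof. by move=> pf pg; apply: ptime_if pf pg _; apply: ptime_const. Qed.

Lemma ptime_orb (X : encType) (f g : X -> bool) :
  ptime f -> ptime g -> ptime (fun x => f x || g x).
Proof. by move=> pf pg; apply: ptime_if pf _ pg; apply: ptime_const. Qed.

Lemma ptime_implyb (X : encType) (f g : X -> bool) :
  ptime f -> ptime g -> ptime (fun x => f x ==> g x).
Proof. by move=> pf pg; apply: ptime_if pf pg _; apply: ptime_const. Qed.

Lemma ptime_has (X Y : encType) (f : X -> Y -> bool) (g : X -> seq Y) :
  ptime (fun p : X * Y => f p.1 p.2) -> ptime g ->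
  ptime (fun x => has (f x) (g x)).
Proof.
move=> pf pg; apply: (@ptime_ext _ _ (fun x => ~~ nilp (filter (f x) (g x)))).
  by move=> x; rewrite /nilp size_filter -lt0n has_count.
exact/ptime_negb/ptime_nilp/ptime_filter.
Qed.

Lemma ptime_all (X Y : encType) (f : X -> Y -> bool) (g : X -> seq Y) :
  ptime (fun p : X * Y => f p.1 p.2) -> ptime g ->
  ptime (fun x => all (f x) (g x)).
Proof.
move=> pf pg; apply: (@ptime_ext _ _ (fun x => ~~ has (fun y => ~~ f x y) (g x))).
  by move=> x; rewrite -all_predC; apply: eq_all => y /=; rewrite negbK.
apply: ptime_negb; apply: (ptime_has (f := fun x y => ~~ f x y)) pg.
exact: ptime_negb.
Qed.

(** * Unary arithmetic and bounded iteration *)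

Lemma enc_nseq n : enc (nseq n tt) = enc n.
Proof. by elim: n => // n IH; apply: (congr1 (Cons Nil) IH). Qed.

Lemma ptime_nseq (X : encType) (f : X -> nat) : ptime f -> ptime (fun x => nseq (f x) tt).
Proof.
apply: (@ptime_comp X nat_enc (seq_enc unit_enc) (nseq^~ tt)).
by apply: (@ptime_expr _ _ _ (EVar 0)) => // s n; rewrite enc_nseq.
Qed.

(** A unary counter doubles as a list of [tt], so iteration is a fold that ignores the entries. *)
Lemma ptime_iter b (X A : encType) (F : X -> A -> A) (n : X -> nat) (i : X -> A) :
  pol b -> ptime (fun p : X * A => F p.1 p.2) -> ptime n -> ptime i ->
  (forall x k, k <= n x -> esz (iter k (F x) (i x)) <= b (esz x)) ->
  ptime (fun x => iter (n x) (F x) (i x)).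
Proof.
move=> pb pF pn pi hb.
have iterE k x a : foldl (fun a _ => F x a) a (nseq k tt) = iter k (F x) a.
  by elim: k a => //= k IH a; rewrite IH -iterSr.
apply: (@ptime_ext _ _ (fun x => foldl (fun a _ => F x a) (i x) (nseq (n x) tt))) => //.
apply: (@ptime_foldlB b _ _ _ (fun x _ => F x)) => //.
- by apply: (ptime_comp2 pF); [|apply: ptime_snd]; [apply: ptime_fst|apply: ptime_snd];
    apply: ptime_id.
- exact: ptime_nseq.
- move=> x k; have [le_k|/ltnW le_k] := leqP k (n x).
    by rewrite take_nseq // iterE hb.
  by rewrite take_oversize ?size_nseq // iterE hb.
Qed.

Lemma ptime_S (X : encType) (f : X -> nat) : ptime f -> ptime (fun x => (f x).+1).
Proof.
apply: (@ptime_comp X _ nat_enc succn).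
by apply: (@ptime_expr _ _ _ (ECons ENil (EVar 0))) => // s n /= ->.
Qed.

Lemma ptime_pred (X : encType) (f : X -> nat) : ptime f -> ptime (fun x => (f x).-1).
Proof.
apply: (@ptime_comp X _ nat_enc predn).
by apply: (@ptime_expr _ _ _ (ETl (EVar 0))) => // s [|n] /= ->.
Qed.

Lemma ptime_addl (X : encType) k (f : X -> nat) : ptime f -> ptime (fun x => k + f x).
Proof. by move=> pf; elim: k => // k IH; apply: ptime_S IH. Qed.

Lemma esz_nat (n : nat) : esz n = n.*2.+1.
Proof. by elim: n => // n IH; apply: (congr1 (fun k => k.+2) IH). Qed.

Lemma esz_iota m n : esz (iota m n) <= n.+1 * ((m + n).*2.+3).
Proof.
elim: n m => // n IH m; rewrite /= esz_cons esz_nat.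
by have := IH m.+1; rewrite -!muln2; lia.
Qed.

Lemma ptime_subn (X : encType) (f g : X -> nat) :
  ptime f -> ptime g -> ptime (fun x => f x - g x).
Proof.
move=> pf pg; have [d sf] := ptime_size pf.
have iterE k a : iter k predn a = a - k.
  by elim: k => [|k /= ->]; rewrite ?subn0 // subnS.
apply: (@ptime_ext _ _ (fun x => iter (g x) predn (f x))) => [x|]; first exact: iterE.
apply: (@ptime_iter (fun n => n.+2 ^ d) _ nat_enc (fun _ => predn)) => //.
- by pol_auto.
- exact/ptime_pred/ptime_snd/ptime_id.
- by move=> x k _; rewrite iterE; apply: leq_trans (sf x); rewrite !esz_nat; lia.
Qed.

Lemma ptime_leq (X : encType) (f g : X -> nat) :
  ptime f -> ptime g -> ptime (fun x => f x <= g x).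
Proof.
move=> pf pg; apply: (@ptime_ext _ _ (fun x => nilp (nseq (f x - g x) tt))).
  by move=> x; rewrite /nilp size_nseq.
exact/ptime_nilp/ptime_nseq/ptime_subn.
Qed.

Lemma ptime_eqn (X : encType) (f g : X -> nat) :
  ptime f -> ptime g -> ptime (fun x => f x == g x).
Proof.
move=> pf pg; apply: (@ptime_ext _ _ (fun x => (f x <= g x) && (g x <= f x))).
  by move=> x; rewrite eqn_leq.
by apply: ptime_andb; apply: ptime_leq.
Qed.

Lemma ptime_mem (X : encType) (f : X -> nat) (g : X -> seq nat) :
  ptime f -> ptime g -> ptime (fun x => f x \in g x).
Proof.
move=> pf pg; apply: (@ptime_ext _ _ (fun x => has (fun y => y == f x) (g x))).
  by move=> x; rewrite -has_pred1.
apply: (@ptime_has _ nat_enc (fun x y => y == f x)) pg; apply: ptime_eqn.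
  exact/ptime_snd/ptime_id.
by apply: (ptime_comp pf); apply/ptime_fst/ptime_id.
Qed.

Lemma ptime_nth (X Y : encType) (y0 : Y) (g : X -> seq Y) (f : X -> nat) :
  enc y0 = Nil -> ptime g -> ptime f -> ptime (fun x => nth y0 (g x) (f x)).
Proof.
move=> y0N pg pf; have [d sg] := ptime_size pg.
have iterE k (l : seq Y) : iter k behead l = drop k l.
  elim: k l => [|k IH] l; first by rewrite drop0.
  by rewrite iterSr IH; case: l.
apply: (@ptime_ext _ _ (fun x => head y0 (iter (f x) behead (g x)))) => [x|].
  by rewrite iterE -nth0 nth_drop addn0.
apply: ptime_head => //.
apply: (@ptime_iter (fun n => n.+2 ^ d) _ _ (fun _ => behead)) => //.
- by pol_auto.
- exact/ptime_behead/ptime_snd/ptime_id.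
- move=> x k _; rewrite iterE; apply: leq_trans (sg x).
  have : esz (g x) = esz (take k (g x) ++ drop k (g x)) by rewrite cat_take_drop.
  rewrite -[take k _]revK -catrevE => ->.
  have := esz_catrev (rev (take k (g x))) (drop k (g x)).
  have := tsize_gt0 (enc (rev (take k (g x)))); lia.
Qed.

Lemma ptime_iota (X : encType) (f : X -> nat) :
  ptime f -> ptime (fun x => iota 0 (f x)).
Proof.
move=> pf; have [d sf] := ptime_size pf.
have iterE k : iter k (fun s => 0 :: map succn s) [::] = iota 0 k.
  by elim: k => //= k ->; rewrite -(iotaDl 1 0).
apply: (@ptime_ext _ _ (fun x => iter (f x) (fun s => 0 :: map succn s) [::])) => //.
apply: (@ptime_iter (fun n => (n.+2 ^ d).+1 * (n.+2 ^ d).+2) _ (seq_enc nat_enc)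
          (fun _ s => 0 :: map succn s)) => //.
- by pol_auto.
- apply: ptime_cons; first exact: ptime_const.
  apply: (ptime_map (f := fun _ => succn)); last exact/ptime_snd/ptime_id.
  exact/ptime_S/ptime_snd/ptime_id.
- exact: ptime_const.
- move=> x k hk; rewrite iterE; have := sf x; rewrite esz_nat => hx.
  apply: leq_trans (esz_iota 0 k) _.
  by apply: leq_mul; lia.
Qed.

(** * Reconfiguration of bicliques *)

Definition closed_nbhd (T : finType) (G : graph T) (A : {set T}) : {set T} :=
  A :|: [set v | [forall u in A, G v u]].

Definition bislice (T : finType) (G : graph T) (A V : {set T}) :=
  (A \subset V) && (V \subset closed_nbhd G A).

(** One class [A] determines the other as [V :\: A], and the only edges required are those between
    the two. Hence every vertex of [V] outside [A] must be a common neighbour of [A], and nothing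
    more is asked. *)
Lemma feasible_bicliqueP (i j : nat) (T : finType) (G : graph T) (V : {set T}) :
  feasible (biclique i j) G V <->
  exists A : {set T}, [/\ #|A| = i, #|V| = i + j & bislice G A V].
Proof.
split=> [[H HG [A [B [AB dAB cA cB HE]]]]|[A [cA cV /andP[AV VA]]]].
  exists (val @: A); split; first by rewrite card_imset //; apply: val_inj.
    transitivity #|[set: {x : T | x \in V}]|; first by rewrite cardsT card_sig.
    by rewrite -AB cardsU (disjoint_setI0 dAB) cards0 subn0 cA cB.
  apply/andP; split; apply/subsetP => x.
    by case/imsetP=> -[y yV] _ ->.
  move=> xV; rewrite inE; have : Sub x xV \in A :|: B by rewrite AB inE.
  case/setUP=> [xA|xB]; first by rewrite (imset_f val xA).
  apply/orP; right; rewrite inE; apply/forall_inP => _ /imsetP[y yA ->].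
  have : H (Sub x xV) y by rewrite HE xB yA orbT.
  by move/HG.
(* The spanning biclique keeps exactly the edges with one end in [A], which the exclusive or
   expresses symmetrically. *)
pose A' : {set {x : T | x \in V}} := [set x | val x \in A].
have h_sym : symmetric [rel x y : {x | x \in V} | (x \in A') (+) (y \in A')].
  by move=> x y /=; rewrite addbC.
have h_irr : irreflexive [rel x y : {x | x \in V} | (x \in A') (+) (y \in A')].
  by move=> x /=; rewrite addbb.
have cA' : #|A'| = i.
  rewrite -cA -(card_imset _ val_inj); apply: eq_card => x.
  apply/imsetP/idP => [[y]|xA]; first by rewrite inE => ? ->.
  by exists (Sub x (subsetP AV x xA)); rewrite ?inE.
have nbr x y : x \in V -> x \notin A -> y \in A -> G x y.
  move=> xV xA yA; have := subsetP VA x xV.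
  by rewrite !inE (negbTE xA) => /forall_inP; apply.
exists (Graph h_sym h_irr).
  move=> [x xV] [y yV] /=; rewrite !inE /=.
  have [xA|xA] := boolP (x \in A); have [yA|yA] := boolP (y \in A) => //= _.
    by change (is_true (G x y)); rewrite adj_sym nbr.
  exact: nbr.
exists A', (~: A'); split=> //.
- exact: setUCr.
- by rewrite -setI_eq0 setICr.
- by rewrite cardsCs setCK cA' card_sig cV addKn.
- by move=> x y /=; rewrite !in_setC; do 2!case: (_ \in A').
Qed.

(** * Slices with equal or adjacent solutions *)

Definition slice_linked (T : finType) (G : graph T) (k : nat) (A B : {set T}) :=
  [&& #|A :\: closed_nbhd G B| <= 1, #|B :\: closed_nbhd G A| <= 1,
      k <= #|closed_nbhd G A :&: closed_nbhd G B|.+1 & #|A :|: B| <= k.+1].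

Lemma interval_card (T : finType) (L U : {set T}) k : L \subset U ->
  #|L| <= k <= #|U| -> exists V : {set T}, [/\ L \subset V, V \subset U & #|V| = k].
Proof.
move=> LU; elim: k => [|k IH] /andP[Lk kU].
  by exists L; split=> //; apply/eqP; rewrite -leqn0.
have [Lk'|Lk'] := leqP #|L| k; last by exists L; split=> //; lia.
have [V [LV VU cV]] := IH ltac:(lia).
have : 0 < #|U :\: V| by have := cardsID V U; rewrite (setIidPr VU); lia.
case/card_gt0P => x; rewrite inE => /andP[xV xU]; exists (x |: V); split.
- exact: subset_trans LV (subsetUr _ _).
- by rewrite subUset sub1set xU.
- by rewrite cardsU1 xV cV.
Qed.

Lemma jumpsP (T : finType) (V W : {set T}) x y : x != y -> x \notin W -> y \notin W ->
  token_jump (x |: W) (y |: W).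
Proof.
have half x' y' : x' != y' -> x' \notin W -> #|(x' |: W) :\: (y' |: W)| = 1.
  move=> xy xW; apply/eqP/cards1P; exists x'; apply/setP => z; rewrite !inE.
  case: (z =P x') => [->|_] /=; first by rewrite (negbTE xy) (negbTE xW).
  by case: (z \in W); rewrite ?orbT ?andbF.
by move=> xy xW yW; apply/andP; split; apply/eqP; apply: half => //; rewrite eq_sym.
Qed.

Lemma card_setD_rem (T : finType) (L P : {set T}) y :
  #|L :\: (P :\ y)| <= #|L :\: P| + (y \in L).
Proof.
have [yL|yL] := boolP (y \in L); last first.
  rewrite addn0; apply/subset_leq_card/subsetP => z; rewrite !inE.
  by case: (z =P y) => [->|]; rewrite ?(negbTE yL) ?andbF.
have : L :\: (P :\ y) \subset y |: (L :\: P).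
  by apply/subsetP => z; rewrite !inE; case: (z == y).
move=> /subset_leq_card /leq_trans; apply.
by rewrite cardsU1 addnC leq_add2l; case: (_ \notin _).
Qed.

Lemma card_gt_setD (T : finType) (P L : {set T}) : #|P :&: L| < #|P| ->
  exists2 y, y \in P & y \notin L.
Proof.
rewrite -(cardsID L P) -{1}[#|_ :&: _|]addn0 ltn_add2l => /card_gt0P[y].
by rewrite inE => /andP[yL yP]; exists y.
Qed.

(* [W] is the intended intersection of the two jumping sets. If [P] below has at
   most [k] elements, [W] is any set between [P] and [U :&: U']; otherwise [P]
   has [k + 1] or [k + 2] elements and [W] is [P] without one or two of them. *)
Lemma linked_core (T : finType) (L U L' U' : {set T}) k :
  L \subset U -> L' \subset U' -> #|L| <= k.+1 -> #|L'| <= k.+1 ->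
  #|L :\: U'| <= 1 -> #|L' :\: U| <= 1 -> k <= #|U :&: U'| -> #|L :|: L'| <= k.+2 ->
  exists W : {set T}, [/\ W \subset U :&: U', #|W| = k, #|L :\: W| <= 1 & #|L' :\: W| <= 1].
Proof.
move=> LU LU' cL cL' a1 b1 cI cM.
set P := (L :|: L') :&: (U :&: U').
have PI : P \subset U :&: U' by exact: subsetIr.
have aE : L :\: P = L :\: U'.
  apply/setP => z; rewrite !inE; case: (boolP (z \in L)) => [/(subsetP LU) ->|] /=.
    by rewrite !andbT.
  by rewrite !andbF.
have bE : L' :\: P = L' :\: U.
  apply/setP => z; rewrite !inE; case: (boolP (z \in L')) => [/(subsetP LU') ->|] /=.
    by rewrite orbT /= !andbT.
  by rewrite !andbF.
(* [L :\: P] avoids [U'] while [L' :\: P] lies in [L'], hence in [U'], so the union splits into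
   three disjoint parts. *)
have cP : #|P| + #|L :\: P| + #|L' :\: P| = #|L :|: L'|.
  rewrite -(cardsID (U :&: U') (L :|: L')) -addnA; congr (_ + _).
  have -> : (L :|: L') :\: (U :&: U') = (L :\: P) :|: (L' :\: P).
    apply/setP => z; rewrite !inE.
    by case: (z \in L); case: (z \in L'); case: (z \in U); case: (z \in U').
  rewrite cardsU [X in _ = _ - #|pred_of_set X|](_ : _ = set0) ?cards0 ?subn0 //.
  apply/setP => z; rewrite aE bE !inE.
  by case: (boolP (z \in L)) => [/(subsetP LU) ->|]; rewrite ?andbF.
rewrite -aE in a1; rewrite -bE in b1.
have [Pk|kP] := leqP #|P| k.
  have [W [PW WI cW]] := interval_card PI (introT andP (conj Pk cI)).
  by exists W; split=> //; [apply: leq_trans a1|apply: leq_trans b1];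
    apply/subset_leq_card/setDS.
have cPL : #|P :&: L| + #|L :\: P| = #|L| by rewrite setIC cardsID.
have cPL' : #|P :&: L'| + #|L' :\: P| = #|L'| by rewrite setIC cardsID.
have [Pk|kP'] := leqP #|P| k.+1.
  have [y yP [ya yb]] : exists2 y, y \in P &
      #|L :\: P| + (y \in L) <= 1 /\ #|L' :\: P| + (y \in L') <= 1.
    (* Here [P] has [k.+1] elements. If [L] already misses one element, the bound on [L] leaves some
       [y] in [P] outside [L], and the bound on the union forces [L'] into [P], so [L'] can spare
       [y]. The case of [L'] is symmetric; if neither misses any, every [y] works. *)
    have [a0|a0] := posnP #|L :\: P|; last first.
      case: (@card_gt_setD _ P L) => [|y yP /negbTE yL]; first by lia.
      by exists y => //; rewrite yL; case: (y \in L'); lia.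
    have [b0|b0] := posnP #|L' :\: P|; last first.
      case: (@card_gt_setD _ P L') => [|y yP /negbTE yL]; first by lia.
      by exists y => //; rewrite yL; case: (y \in L); lia.
    case/card_gt0P: (leq_ltn_trans (leq0n k) kP) => y yP; exists y => //.
    by rewrite a0 b0; case: (y \in L); case: (y \in L').
  exists (P :\ y); split.
  - exact: subset_trans (subsetDl _ _) PI.
  - by have := cardsD1 y P; rewrite yP; lia.
  - exact: leq_trans (card_setD_rem _ _ _) ya.
  - exact: leq_trans (card_setD_rem _ _ _) yb.
(* Here [P] has [k.+2] elements, so it is all of [L :|: L']. Both [L] and [L'] are smaller; dropping
   [y] outside [L] and [x] outside [L'] costs each of them at most one element. *)
case: (@card_gt_setD _ P L) => [|y yP yL]; first by lia.
case: (@card_gt_setD _ P L') => [|x xP xL]; first by lia.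
have xy : x != y.
  apply: contraNneq yL => xy; move: xP xL; rewrite xy !inE.
  by case: (y \in L) => //= /andP[->].
exists (P :\ y :\ x); split.
- by do 2!apply: subset_trans (subsetDl _ _) _.
- have := cardsD1 y P; have := cardsD1 x (P :\ y).
  by rewrite yP in_setD1 xy xP /=; move: kP' cP a1 b1 cM; clear; lia.
- apply: leq_trans (card_setD_rem _ _ _) _.
  have := card_setD_rem L P y; rewrite (negbTE yL); case: (x \in L);
    by move: kP' cP a1 b1 cM; clear; lia.
- apply: leq_trans (card_setD_rem _ _ _) _.
  have := card_setD_rem L' P y; rewrite (negbTE xL); case: (y \in L');
    by move: kP' cP a1 b1 cM; clear; lia.
Qed.

(** The vertex [x] is the unique element of [L :\: W] if there is one, and otherwise any element of
    [U :\: W]. *)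
Lemma core_extend (T : finType) (L U W : {set T}) :
  L \subset U -> W \subset U -> #|W| < #|U| -> #|L :\: W| <= 1 ->
  exists x, [/\ x \notin W, L \subset x |: W & x |: W \subset U].
Proof.
move=> LU WU cW cL.
have [x [xW xU Lx]] : exists x, [/\ x \notin W, x \in U & L :\: W \subset [set x]].
  have [/eqP L0|/card_gt0P[x]] := posnP #|L :\: W|.
    have [|x xU xW] := @card_gt_setD _ U W; first by rewrite (setIidPr WU).
    by exists x; split=> //; move: L0; rewrite cards_eq0 => /eqP ->; exact: sub0set.
  rewrite inE => /andP[xW xL]; exists x; split=> //; first exact: (subsetP LU).
  apply/subsetP => z zL; rewrite inE; apply/eqP.
  by apply: (card_le1_eqP cL) => //; rewrite inE xW.
exists x; split=> //; last by rewrite subUset sub1set xU.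
by rewrite setUC -subDset.
Qed.

(** A common core of [k] vertices is completed by one vertex for each slice. If the two added
    vertices agree, the solutions coincide; otherwise they differ by one jump. *)
Lemma linked_jump (T : finType) (G : graph T) k (A B : {set T}) :
  #|A| <= k.+1 <= #|closed_nbhd G A| -> #|B| <= k.+1 <= #|closed_nbhd G B| ->
  slice_linked G k.+1 A B ->
  exists V W : {set T}, [/\ bislice G A V, bislice G B W, #|V| = k.+1, #|W| = k.+1 &
    V = W \/ token_jump V W].
Proof.
move=> /andP[cA cNA] /andP[cB cNB] /and4P[h1 h2 h3 h4].
have AN : A \subset closed_nbhd G A by exact: subsetUl.
have BN : B \subset closed_nbhd G B by exact: subsetUl.
have [C [CI cC CA CB]] := linked_core AN BN cA cB h1 h2 h3 h4.
have /andP[CNA CNB] : (C \subset closed_nbhd G A) && (C \subset closed_nbhd G B).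
  by rewrite -subsetI.
have [|x [xC Ax xN]] := core_extend AN CNA _ CA; first by rewrite cC.
have [|y [yC By yN]] := core_extend BN CNB _ CB; first by rewrite cC.
exists (x |: C), (y |: C); rewrite /bislice Ax xN By yN !cardsU1 xC yC cC; split=> //.
by have [->|/jumpsP h] := eqVneq x y; [left|right; apply: h].
Qed.

(** All four conditions follow by monotonicity from [V] and [W]: for instance
    [A :\: closed_nbhd G B] is contained in [V :\: W]. The bounds on the differences allow [V = W]
    as well as a jump. *)
Lemma jump_linked (T : finType) (G : graph T) k (A B V W : {set T}) :
  bislice G A V -> bislice G B W -> #|V| = k -> #|V :\: W| <= 1 -> #|W :\: V| <= 1 ->
  slice_linked G k A B.
Proof.
move=> /andP[AV VN] /andP[BW WN] cV h1 h2; apply/and4P; split.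
- exact: leq_trans (subset_leq_card (setDSS AV WN)) h1.
- exact: leq_trans (subset_leq_card (setDSS BW VN)) h2.
- have := subset_leq_card (setISS VN WN); have := cardsID W V; lia.
- have := subset_leq_card (setUSS AV BW); have := cardsID V W.
  by rewrite (cardsU V W) [W :&: V]setIC; lia.
Qed.

(** * From reconfiguration sequences to paths of slices *)

Lemma reconf_refl P (T : finType) (G : graph T) V :
  feasible P G V -> reconfigurable P G V V.
Proof. by move=> h; exists [::]; split=> // X; rewrite inE => /eqP ->. Qed.

Lemma reconf_jump P (T : finType) (G : graph T) U V W :
  feasible P G U -> token_jump U V -> reconfigurable P G V W -> reconfigurable P G U W.
Proof.
move=> hU hUV [p [h1 h2 h3]]; exists (V :: p); split=> //.
  by rewrite /= -/(token_jump U V) hUV.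
by move=> X; rewrite inE => /predU1P[-> //|]; apply: h3.
Qed.

Lemma reconf_trans P (T : finType) (G : graph T) U V W :
  reconfigurable P G U V -> reconfigurable P G V W -> reconfigurable P G U W.
Proof.
move=> [p [h1 h2 h3]] VW; elim: p U h1 h2 h3 => [|X p IH] U /=; first by move=> _ ->.
move=> /andP[hj hp] hl hf; apply: (@reconf_jump _ _ _ _ X) => //.
  by apply: hf; rewrite inE eqxx.
by apply: IH => // Y hY; apply: hf; rewrite inE hY orbT.
Qed.

(** Induction on the size of [V :\: W]: a vertex [x] of [V :\: W] is exchanged for a vertex [y] of
    [W :\: V]. As [A] lies in [W], [x] is outside [A], and [y] is in the closed neighbourhood, so
    the slice is not left. *)
Lemma slice_reconf i j (T : finType) (G : graph T) (A V W : {set T}) :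
  #|A| = i -> bislice G A V -> bislice G A W -> #|V| = i + j -> #|W| = i + j ->
  reconfigurable (biclique i j) G V W.
Proof.
move=> cA; move: {2}#|_| (leqnn #|V :\: W|) => d.
elim: d V => [|d IH] V hd hV hW cV cW.
  have -> : V = W.
    apply/eqP; rewrite eqEcard cV cW leqnn andbT.
    by rewrite -setD_eq0 -cards_eq0 -leqn0.
  by apply: reconf_refl; apply/feasible_bicliqueP; exists A.
have [|] := leqP #|V :\: W| d; first by move=> h; exact: IH.
move=> hd'; have cWV : #|W :\: V| = #|V :\: W|.
  by have := cardsID V W; have := cardsID W V; rewrite setIC; lia.
have /card_gt0P[x] : 0 < #|V :\: W| by lia.
have /card_gt0P[y] : 0 < #|W :\: V| by lia.
rewrite !inE => /andP[yV yW] /andP[xW xV].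
case/andP: (hV) => AV VN; case/andP: (hW) => AW WN.
have yx : y != x by apply: contraNneq yV => ->.
have xA : x \notin A by apply: contra xW; apply: (subsetP AW).
have yVx : y \notin V :\ x by rewrite inE (negbTE yV) andbF.
apply: (@reconf_jump _ _ _ _ (y |: V :\ x)).
- by apply/feasible_bicliqueP; exists A.
- by rewrite -{1}(setD1K xV) jumpsP 1?eq_sym // !inE eqxx.
apply: IH => //.
- have : (y |: V :\ x) :\: W \subset (V :\: W) :\ x.
    apply/subsetP => z; rewrite !inE; case: (z =P y) => [->|_]; first by rewrite yW.
    by case: (z == x); rewrite ?andbF.
  move/subset_leq_card/leq_trans; apply.
  by move: hd; rewrite (cardsD1 x (V :\: W)) !inE xV xW.
- apply/andP; split; last by rewrite subUset sub1set (subsetP WN) //= (subset_trans (subsetDl _ _)).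
  apply/subsetP => z zA; rewrite !inE (subsetP AV) // andbT orbC.
  by have -> : z != x by apply: contraNneq xA => <-.
- by rewrite cardsU1 yVx -cV (cardsD1 x V) xV.
Qed.

(** For [i <= k] the second condition says that the slice of [A] contains a set of size [k]. *)
Definition slice_node (T : finType) (G : graph T) (i k : nat) (A : {set T}) :=
  (#|A| == i) && (k <= #|closed_nbhd G A|).

Definition slice_edge (T : finType) (G : graph T) (i k : nat) : rel {set T} :=
  [rel A B | slice_node G i k B && slice_linked G k A B].

Lemma reconfigurable_bicliqueP i j (T : finType) (G : graph T) (Vs Vt : {set T}) :
  0 < i -> #|Vs| = i + j -> #|Vt| = i + j ->
  reconfigurable (biclique i j) G Vs Vt <->
  exists (A : {set T}) (p : seq {set T}),
    [/\ slice_node G i (i + j) A, bislice G A Vs, path (slice_edge G i (i + j)) A p &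
        bislice G (last A p) Vt].
Proof.
move=> i0 cVs cVt.
have node (A V : {set T}) : #|A| = i -> bislice G A V -> #|V| = i + j -> slice_node G i (i + j) A.
  move=> cA /andP[_ VN] cV; rewrite /slice_node cA eqxx -cV; exact: subset_leq_card.
split=> [[p [hp hl hf]]|[A [p [hA As hp hl]]]].
  have /feasible_bicliqueP[A [cA cV AV]] := hf Vs (mem_head _ _).
  exists A; suff [q hq hql] : exists2 q, path (slice_edge G i (i + j)) A q &
      bislice G (last A q) Vt by exists q; split=> //; apply: node AV cV.
  elim: p Vs A hp hl hf cA cV AV {cVs} => [|W p IH] V A /=.
    by move=> _ <- _ _ _ AV; exists [::].
  move=> /andP[VW hp] hl hf cA cV AV.
  have /feasible_bicliqueP[B [cB cW BW]] : feasible (biclique i j) G W.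
    by apply: hf; rewrite !inE eqxx orbT.
  have [|q hq hql] := IH W B hp hl _ cB cW BW.
    by move=> X hX; apply: hf; rewrite inE hX orbT.
  exists (B :: q) => //=; rewrite hq andbT; apply/andP; split; first exact: node BW cW.
  by case/andP: VW => /eqP h1 /eqP h2; apply: (jump_linked AV BW cV); rewrite ?h1 ?h2.
elim: p A Vs hA As hp hl cVs => [|B p IH] A V /= hA AV.
  by move=> _ hl cV; apply: slice_reconf hl cV cVt => //; case/andP: hA => /eqP.
move=> /andP[/andP[hB AB] hp] hl cV.
case/andP: (hA) (hB) => /eqP cA NA /andP[/eqP cB NB].
(* [linked_jump] takes a core of one vertex less than a solution, so [i + j] must be a successor;
   this is where [0 < i] enters. *)
case: i i0 hA hB hp AB cA cB NA NB cV cVt {node} IH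
  => // i _ hA hB hp AB cA cB NA NB cV cVt IH.
have [||V' [W' [hV' hW' cV' cW' VW']]] := @linked_jump _ G (i + j) A B _ _ AB.
- by rewrite cA NA ltnS leq_addr.
- by rewrite cB NB ltnS leq_addr.
apply: (@reconf_trans _ _ _ _ V'); first exact: slice_reconf AV hV' cV cV'.
have hW : reconfigurable (biclique i.+1 j) G W' Vt by apply: IH hl cW'.
case: VW' => [-> //|hj]; apply: reconf_jump hj hW.
by apply/feasible_bicliqueP; exists A.
Qed.

(** * The decision procedure *)

(* Parameter, adjacency matrix, source and target, nested as in [encode]. *)
Definition raw := (nat * (seq (seq bool) * (seq bool * (seq bool * unit))))%type.

Definition raw_enc : encType :=
  prod_enc nat_enc (prod_enc (seq_enc (seq_enc bool_enc))
    (prod_enc (seq_enc bool_enc) (prod_enc (seq_enc bool_enc) unit_enc))).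

Definition verts (r : raw) : seq nat := iota 0 (size r.2.1).

Definition in_nbhd (r : raw) (A : seq nat) (v : nat) : bool :=
  (v \in A) || all (fun u => nth false (nth [::] r.2.1 v) u) A.

(** A word may repeat a vertex, so the size of the set it lists is obtained by counting the vertices
    that occur in it. *)
Definition is_node (i : nat) (r : raw) (A : seq nat) : bool :=
  (count (fun v => v \in A) (verts r) == i) &&
  (i + r.1 <= count (in_nbhd r A) (verts r)).

Definition is_linked (i : nat) (r : raw) (A B : seq nat) : bool :=
  [&& count (fun v => (v \in A) && ~~ in_nbhd r B v) (verts r) <= 1,
      count (fun v => (v \in B) && ~~ in_nbhd r A v) (verts r) <= 1,
      i + r.1 <= (count (fun v => in_nbhd r A v && in_nbhd r B v) (verts r)).+1 &
      count (fun v => (v \in A) || (v \in B)) (verts r) <= (i + r.1).+1].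

Definition in_slice (r : raw) (V : seq bool) (A : seq nat) : bool :=
  all (fun v => ((v \in A) ==> nth false V v) && (nth false V v ==> in_nbhd r A v))
      (verts r).

Fixpoint words (r : raw) (l : nat) : seq (seq nat) :=
  if l is l'.+1 then [seq a :: A | a <- verts r, A <- words r l'] else [:: [::]].

Definition nodes (i : nat) (r : raw) := [seq A <- words r i | is_node i r A].

(** Filtering [nodes i r] instead of extending [R] keeps every iterate at most as long as that
    list. *)
Definition expand (i : nat) (r : raw) (R : seq (seq nat)) : seq (seq nat) :=
  [seq B <- nodes i r | has (fun A => is_linked i r A B) R].

Definition sources (i : nat) (r : raw) : seq (seq nat) :=
  [seq A <- nodes i r | in_slice r r.2.2.1 A].

Definition reached (i : nat) (r : raw) (n : nat) : seq (seq nat) :=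
  iter n (expand i r) (sources i r).

Definition decide (i : nat) (r : raw) : bool :=
  has (in_slice r r.2.2.2.1) (reached i r (size (nodes i r))).

Ltac pt :=
  match goal with
  | |- ptime (fun x => x) => exact: ptime_id
  | |- ptime id => exact: ptime_id
  | |- ptime fst => exact: (ptime_fst (@ptime_id _))
  | |- ptime snd => exact: (ptime_snd (@ptime_id _))
  | H : ptime ?g |- ptime ?g => exact: H
  | H : ptime ?g |- ptime (fun x => ?g (@?f x)) => apply: (@ptime_comp _ _ _ g f H); pt
  | |- ptime (fun=> _) => exact: ptime_const
  | |- ptime (fun x => fst _) => apply: ptime_fst; pt
  | |- ptime (fun x => snd _) => apply: ptime_snd; pt
  | |- ptime (fun x => andb _ _) => apply: ptime_andb; pt
  | |- ptime (fun x => orb _ _) => apply: ptime_orb; pt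
  | |- ptime (fun x => implb _ _) => apply: ptime_implyb; pt
  | |- ptime (fun x => negb _) => apply: ptime_negb; pt
  | |- ptime (fun x => S _) => apply: ptime_S; pt
  | |- ptime (fun x => addn _ _) => apply: ptime_addl; pt
  | |- ptime (fun x => size _) => apply: ptime_size_seq; pt
  | |- ptime (fun x => leq _ _) => apply: ptime_leq; pt
  | |- ptime (fun x => cons _ _) => apply: ptime_cons; pt
  | |- ptime (fun x => nth _ _ _) => apply: ptime_nth => //; pt
  | |- ptime (fun x => iota 0 _) => apply: ptime_iota; pt
  | |- ptime (fun x => _ \in _) => apply: ptime_mem; pt
  | |- ptime (fun x => eq_op _ _) => apply: ptime_eqn; pt
  | |- ptime (fun x => flatten _) => apply: ptime_flatten; pt
  | |- ptime (fun x => all (@?P x) (@?g x)) => apply: (@ptime_all _ _ P g); pt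
  | |- ptime (fun x => has (@?P x) (@?g x)) => apply: (@ptime_has _ _ P g); pt
  | |- ptime (fun x => count (@?P x) (@?g x)) => apply: (@ptime_count _ _ P g); pt
  | |- ptime (fun x => filter (@?P x) (@?g x)) => apply: (@ptime_filter _ _ P g); pt
  | |- ptime (fun x => map (@?P x) (@?g x)) => apply: (@ptime_map _ _ _ P g); pt
  | _ => idtac
  end.

(** * Polynomial running time of the procedure *)

Lemma ptime_in_nbhd (X : encType) (r : X -> raw_enc) A v : ptime r -> ptime A -> ptime v ->
  ptime (fun x => in_nbhd (r x) (A x) (v x)).
Proof. by rewrite /in_nbhd => pr pA pv; pt. Qed.

Lemma ptime_is_node i (X : encType) (r : X -> raw_enc) A : ptime r -> ptime A ->
  ptime (fun x => is_node i (r x) (A x)).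
Proof. by rewrite /is_node /verts => pr pA; pt; apply: ptime_in_nbhd; pt. Qed.

Lemma ptime_is_linked i (X : encType) (r : X -> raw_enc) A B :
  ptime r -> ptime A -> ptime B -> ptime (fun x => is_linked i (r x) (A x) (B x)).
Proof.
by rewrite /is_linked /verts => pr pA pB; pt; apply: ptime_in_nbhd; pt.
Qed.

Lemma ptime_in_slice (X : encType) (r : X -> raw_enc) V A :
  ptime r -> ptime V -> ptime A -> ptime (fun x => in_slice (r x) (V x) (A x)).
Proof. by rewrite /in_slice /verts => pr pV pA; pt; apply: ptime_in_nbhd; pt. Qed.

(** Induction on [l] builds a separate program for each length, with a degree that may depend on
    [l]. This is where [i] being constant is used. *)
Lemma ptime_words l : ptime (fun r : raw_enc => words r l).
Proof.
rewrite /verts; elim: l => [|l IH] /=; first exact: ptime_const.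
by rewrite /verts; pt; apply: (ptime_comp IH); pt.
Qed.

Lemma ptime_nodes i : ptime (nodes i : raw_enc -> _).
Proof. by rewrite /nodes; have pw := ptime_words i; pt; apply: ptime_is_node; pt. Qed.

Lemma ptime_decide i : ptime (decide i : raw_enc -> _).
Proof.
have pn := ptime_nodes i; have [d sn] := ptime_size pn.
rewrite /decide /reached.
have pr : ptime (fun r : raw_enc => iter (size (nodes i r)) (expand i r) (sources i r)).
  (* All iterates are filters of [nodes i r], so its polynomial size bounds every accumulator. *)
  have le_filter (Y : encType) p (l : seq Y) : esz (filter p l) <= esz l.
    by elim: l => //= y l IH; case: (p y); rewrite !esz_cons; lia.
  apply: (@ptime_iter (fun n => n.+2 ^ d) raw_enc (seq_enc (seq_enc nat_enc)) (expand i)).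
  - by pol_auto.
  - by rewrite /expand; pt; apply: ptime_is_linked; pt.
  - by pt.
  - by rewrite /sources; pt; apply: ptime_in_slice; pt.
  - by move=> r [|k] _ /=; apply: leq_trans (sn r); apply: le_filter.
by pt; apply: ptime_in_slice; pt.
Qed.

(** * Correctness of the procedure *)

Definition raw_of (x : instance) : raw :=
  (param x, ([seq [seq input_graph x u v | v <- enum 'I_(order x)] | u <- enum 'I_(order x)],
    ([seq v \in source x | v <- enum 'I_(order x)],
      ([seq v \in target x | v <- enum 'I_(order x)], tt)))).

Lemma enc_map (X : encType) (T : Type) (f : T -> X) (l : seq T) :
  enc (map f l) = enc_seq [seq enc (f v) | v <- l].
Proof. by rewrite [LHS]/(enc_seq _) -map_comp. Qed.

(** The final [tt] becomes the [Nil] that ends the list in [encode], so nested pairs and list give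
    the same tree. *)
Lemma encode_raw x : encode x = enc (raw_of x : raw_enc).
Proof.
transitivity (Cons (enc (param x)) (Cons (enc (raw_of x).2.1)
  (Cons (enc (raw_of x).2.2.1) (Cons (enc (raw_of x).2.2.2.1) Nil)))) => //.
rewrite !enc_map /encode /=; congr (Cons _ (Cons (enc_seq _) _)).
by apply: eq_map => u; rewrite enc_map.
Qed.

Definition set_of (n : nat) (A : seq nat) : {set 'I_n} := [set v | val v \in A].
Definition word_of (n : nat) (A : {set 'I_n}) : seq nat := map val (enum A).

Lemma word_ofK n : cancel (@word_of n) (@set_of n).
Proof.
move=> A; apply/setP => v; rewrite inE /word_of mem_map ?mem_enum //; exact: val_inj.
Qed.

Lemma verts_raw x : verts (raw_of x) = map val (enum 'I_(order x)).
Proof. by rewrite /verts /= size_map size_enum_ord val_enum_ord. Qed.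

Lemma count_verts x P : count P (verts (raw_of x)) = #|[set v : 'I_(order x) | P (val v)]|.
Proof. by rewrite verts_raw count_map enumT cardsE cardE size_filter. Qed.

Lemma all_verts x (P : pred nat) : all P (verts (raw_of x)) = [forall v : 'I_(order x), P (val v)].
Proof.
rewrite verts_raw all_map; apply/allP/forallP => [h v|h v _]; last exact: h.
by apply: h; rewrite mem_enum.
Qed.

Lemma nth_enum_map (T : Type) n (t0 : T) (f : 'I_n -> T) v :
  nth t0 (map f (enum 'I_n)) (val v) = f v.
Proof. by rewrite (nth_map v) ?size_enum_ord ?ltn_ord // nth_ord_enum. Qed.

Lemma mem_words x l A : A \in words (raw_of x) l =
  (size A == l) && all (fun v => v < order x) A.
Proof.
elim: l A => [|l IH] A /=; first by rewrite inE; case: A.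
apply/allpairsP/idP => [[[a B] /= [ha hB ->]]|].
  move: ha hB; rewrite IH /verts /= size_map size_enum_ord mem_iota /= add0n eqSS => ->.
  by [].
case: A => // a B /= /andP[hs /andP[ha hB]]; exists (a, B); split=> //.
  by rewrite /verts /= size_map size_enum_ord mem_iota.
by rewrite IH -eqSS hs.
Qed.

(** The letters must be in range: [in_nbhd] tests each letter of [A], while [set_of] forgets those
    that are not vertices. *)
Lemma in_nbhdE x A (v : 'I_(order x)) : all (fun v => v < order x) A ->
  in_nbhd (raw_of x) A (val v) = (v \in closed_nbhd (input_graph x) (set_of _ A)).
Proof.
move=> hA; rewrite /in_nbhd !inE; congr (_ || _).
apply/allP/forall_inP => h u.
  by rewrite inE => /h; rewrite /= !nth_enum_map.
move=> uA; have un := allP hA u uA; have := h (Ordinal un).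
by rewrite inE => /(_ uA); rewrite /= nth_enum_map -[u]/(val (Ordinal un)) nth_enum_map.
Qed.

Lemma is_nodeE i x A : all (fun v => v < order x) A ->
  is_node i (raw_of x) A = slice_node (input_graph x) i (i + param x) (set_of _ A).
Proof.
move=> hA; rewrite /is_node /slice_node !count_verts; congr (_ && (_ <= _)).
by apply: eq_card => v; rewrite inE in_nbhdE.
Qed.

Lemma is_linkedE i x A B :
  all (fun v => v < order x) A -> all (fun v => v < order x) B ->
  is_linked i (raw_of x) A B =
  slice_linked (input_graph x) (i + param x) (set_of _ A) (set_of _ B).
Proof.
move=> hA hB; rewrite /is_linked /slice_linked !count_verts.
congr [&& (_ <= _), (_ <= _), (_ <= _.+1) & (_ <= _)]; apply: eq_card => v;
  by rewrite inE ?in_nbhdE // !in_set // andbC.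
Qed.

Lemma in_sliceE x (V : {set 'I_(order x)}) A : all (fun v => v < order x) A ->
  in_slice (raw_of x) [seq v \in V | v <- enum 'I_(order x)] A =
  bislice (input_graph x) (set_of _ A) V.
Proof.
move=> hA; rewrite /in_slice all_verts.
apply/forallP/andP => [h|[/subsetP h1 /subsetP h2] v].
  split; apply/subsetP => v; move: (h v); rewrite nth_enum_map in_nbhdE //.
    by case/andP=> /implyP h1 _; rewrite inE.
  by case/andP=> _ /implyP.
rewrite nth_enum_map in_nbhdE //; apply/andP; split; apply/implyP; last exact: h2.
by move=> vA; apply: h1; rewrite inE.
Qed.

Lemma mem_nodes i x A : A \in nodes i (raw_of x) =
  [&& size A == i, all (fun v => v < order x) A &
      slice_node (input_graph x) i (i + param x) (set_of _ A)].
Proof.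
rewrite mem_filter mem_words andbC -andbA; case: eqP => //= _.
by case: (boolP (all _ _)) => //= hA; rewrite is_nodeE.
Qed.

Lemma word_of_bound n (A : {set 'I_n}) : all (fun v => v < n) (word_of A).
Proof. by apply/allP => _ /mapP[v _ ->]; apply: ltn_ord. Qed.

Lemma word_of_node i x A : slice_node (input_graph x) i (i + param x) A ->
  word_of A \in nodes i (raw_of x).
Proof.
move=> hA; rewrite mem_nodes word_ofK hA word_of_bound size_map -cardE.
by case/andP: hA => ->.
Qed.

(** Self-links make a slice, once reached, survive every later round of [expand]. *)
Lemma slice_linked_refl (T : finType) (G : graph T) i j A :
  slice_node G i (i + j) A -> slice_linked G (i + j) A A.
Proof.
move=> /andP[/eqP cA kN]; rewrite /slice_linked setIid setUid cA.
have -> : A :\: closed_nbhd G A = set0 by apply/eqP; rewrite setD_eq0 subsetUl.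
by rewrite cards0 /=; lia.
Qed.

Lemma reached_sound i x n B : B \in reached i (raw_of x) n ->
  B \in nodes i (raw_of x) /\ exists (A : {set 'I_(order x)}) (p : seq {set 'I_(order x)}),
    [/\ slice_node (input_graph x) i (i + param x) A, bislice (input_graph x) A (source x),
        path (slice_edge (input_graph x) i (i + param x)) A p & last A p = set_of _ B].
Proof.
elim: n B => [|n IH] B; rewrite /reached /= mem_filter.
  move=> /andP[hs hB]; split=> //; exists (set_of _ B), [::].
  by move: hB; rewrite mem_nodes => /and3P[_ hA hn]; rewrite -in_sliceE.
move=> /andP[/hasP[C hC hCB] hB]; split=> //.
have [hC' [A [p [h1 h2 h3 h4]]]] := IH _ hC; exists A, (rcons p (set_of _ B)).
rewrite last_rcons rcons_path h4 h3; split=> //=.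
move: hB hC'; rewrite !mem_nodes /slice_edge /= => /and3P[_ bB ->] /and3P[_ bC _].
by rewrite -is_linkedE.
Qed.

(** Of the many words listing a set, the canonical [word_of] is followed; one round of expansion
    advances it along one edge of the path. *)
Lemma reached_complete i x A p n :
  slice_node (input_graph x) i (i + param x) A ->
  path (slice_edge (input_graph x) i (i + param x)) A p ->
  word_of A \in reached i (raw_of x) n ->
  word_of (last A p) \in reached i (raw_of x) (size p + n).
Proof.
elim: p A n => [|B p IH] A n hA; first by [].
rewrite [path _ _ _]/= [last _ _]/= [size _]/= addSnnS => /andP[/andP[hB AB] hp] hr.
apply: IH => //; rewrite /reached /= mem_filter word_of_node // andbT.
by apply/hasP; exists (word_of A) => //; rewrite is_linkedE ?word_of_bound // !word_ofK.
Qed.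

Lemma reached_mono i x m n : m <= n ->
  {subset reached i (raw_of x) m <= reached i (raw_of x) n}.
Proof.
move=> /subnK <-; elim: (n - m) => // d IH A /IH hA.
have [hn _] := reached_sound hA; rewrite addSn /reached /= mem_filter hn andbT.
apply/hasP; exists A => //; move: hn; rewrite mem_nodes => /and3P[_ bA hn].
by rewrite is_linkedE // slice_linked_refl.
Qed.

Lemma decideP i x : 0 < i ->
  #|source x| = i + param x -> #|target x| = i + param x ->
  decide i (raw_of x) <-> spanning_yes (biclique i) x.
Proof.
move=> i0 cs ct; rewrite /spanning_yes (reconfigurable_bicliqueP _ i0 cs ct).
split=> [/hasP[B hB hBt]|[A [p [hA As hp At]]]].
  have [] := reached_sound hB; rewrite mem_nodes => /and3P[_ bB _] [A [p [h1 h2 h3 h4]]].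
  by exists A, p; rewrite h4 -in_sliceE.
(* On a path without repetition the sets have distinct canonical words, all in [nodes], so its
   length is below the number of rounds, and monotonicity in the number of rounds covers the
   rest. *)
case: (shortenP hp) At => q hq uq _ At.
apply/hasP; exists (word_of (last A q)); last by rewrite in_sliceE ?word_of_bound // word_ofK.
apply: (@reached_mono _ _ (size q + 0)); last first.
  apply: reached_complete => //.
  by rewrite /reached /= mem_filter word_of_node // in_sliceE ?word_of_bound // word_ofK As.
rewrite addn0; apply: ltnW.
have : uniq (map (@word_of _) (A :: q)) by rewrite map_inj_uniq //; apply: can_inj (@word_ofK _).
move/uniq_leq_size => /(_ (nodes i (raw_of x))); rewrite size_map; apply=> _ /mapP[B hB ->].
apply: word_of_node; move: hB; rewrite inE => /predU1P[-> //|].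
elim: q A hq {hp hA As uq At} => //= C q IH A /andP[/andP[hC _] hq].
by rewrite inE => /predU1P[-> //|]; apply: IH hq.
Qed.

Theorem theorem14 (i : nat) (hi : 1 <= i) :
  spanning_TJ_poly_time (biclique i).
Proof.
have [c [m [d hc]]] := ptime_decide i.
(* Since an encoding has size [n >= 1], [n.+2 <= 3 * n], which gives the factor [3 ^ d]. The promise
   supplies the sizes of source and target. *)
exists c, (3 ^ d), d => x [/feasible_bicliqueP[_ [_ cs _]] /feasible_bicliqueP[_ [_ ct _]]].
have [|s' [[t ht le_t] hs' _]] := hc (raw_of x) (init_store (encode x)).
  by rewrite encode_raw.
exists t, s'; split=> //.
  rewrite encode_raw; apply: leq_trans le_t (leq_trans _ (leq_addr _ _)).
  rewrite -expnMn; apply: leq_exp2rW.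
  by have := tsize_gt0 (enc (raw_of x : raw_enc)); lia.
by rewrite hs' -(decideP hi cs ct); case: (decide _ _).
Qed.
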